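(* Let $R$ be a commutative ring with identity, $S$ a multiplicative subset of $R$, $I$ an ideal of $R$ disjoint from $S$, and $n$ a positive integer. Suppose that $R$ is an $S$-Laskerian ring. Then $IR_S$ is an $n$-absorbing ideal of $R_S$ if and only if $I$ is an $S$-$n$-absorbing ideal of $R$.
   Context: A multiplicative subset $S$ of $R$ is a nonempty subset closed under multiplication (not necessarily saturated, and not required to contain $1$). $R_S$ is the localization of $R$ at $S$, and $IR_S$ is the extension of $I$ to $R_S$. An ideal $I$ of $R$ is $n$-absorbing if whenever $r_1,\dots,r_{n+1}\in R$ satisfy $r_1\cdots r_{n+1}\in I$, there is $1\le j\le n+1$ with $\prod_{1\le i\le n+1,\, i\ne j} r_i\in I$. An ideal $I$ of $R$ disjoint from $S$ is $S$-$n$-absorbing if there exists $s\in S$ such that whenever $r_1,\dots,r_{n+1}\in R$ satisfy $r_1\cdots r_{n+1}\in I$, there is $1\le j\le n+1$ with $s\prod_{1\le i\le n+1,\, i\ne j} r_i\in I$. For $s\in R$, $I:s=\{r\in R : sr\in I\}$. An ideal $Q$ of $R$ is $S$-primary if $Q\cap S=\emptyset$ and there exists $s\in S$ such that whenever $ab\in Q$ with $a,b\in R$, either $sa\in Q$ or $sb\in\sqrt{Q}$. $R$ is $S$-Laskerian if for each proper ideal $I$ of $R$ disjoint from $S$ there exists $s\in S$ such that $I:s$ is an intersection of finitely many $S$-primary ideals of $R$. *)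

(* Defs.v *)
From HB Require Import structures.
From mathcomp Require Import all_boot all_algebra ring.
From mathcomp Require Import boolp classical_sets.

Set Implicit Arguments.
Unset Strict Implicit.
Unset Printing Implicit Defensive.

Import GRing.Theory.
Local Open Scope classical_set_scope.
Local Open Scope ring_scope.
Local Open Scope quotient_scope.

Record multset (R : comPzRingType) := MultSet {
  multset_carrier :> set R;
  multset_nonempty : multset_carrier !=set0;
  multset_mul : forall s t,
    multset_carrier s -> multset_carrier t -> multset_carrier (s * t)
}.

(* Since 1 need not lie in S, the unit of the localization is s / s and the
   image of r is (r * s) / s, where s is any element of S. *)
Section Localization.
Variables (R : comPzRingType) (S : multset R).

Definition den (s : S) : R := val s.
Arguments den : simpl never.

Lemma denP (s : S) : (S : set R) (den s).
Proof. exact: set_mem (valP s). Qed.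

Definition den_mul (s t : S) : S :=
  exist _ (den s * den t) (mem_set (multset_mul (denP s) (denP t))).

Lemma den_mulE s t : den (den_mul s t) = den s * den t.
Proof. by []. Qed.

Definition den_witness : S :=
  let: exist s Ss := cid (multset_nonempty S) in exist _ s (mem_set Ss).

Definition loc_rel (x y : R * S) : bool :=
  `[< exists2 u, (S : set R) u & u * (x.1 * den y.2) = u * (y.1 * den x.2) >].

Lemma loc_rel_refl : reflexive loc_rel.
Proof. by move=> x; apply/asboolP; exists (den x.2) => //; exact: denP. Qed.

Lemma loc_rel_sym : symmetric loc_rel.
Proof. by move=> x y; apply/asboolP/asboolP => -[u Su e]; exists u. Qed.

Lemma loc_rel_trans : transitive loc_rel.
Proof.
move=> y x z /asboolP[u Su eu] /asboolP[v Sv ev]; apply/asboolP.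
exists (u * v * den y.2).
  by apply: multset_mul (denP _); exact: multset_mul.
transitivity (v * den z.2 * (u * (x.1 * den y.2))); first by ring.
rewrite eu; transitivity (u * den x.2 * (v * (y.1 * den z.2))); first by ring.
by rewrite ev; ring.
Qed.

Canonical loc_rel_equiv :=
  EquivRel loc_rel loc_rel_refl loc_rel_sym loc_rel_trans.

Definition localization := {eq_quot loc_rel}.

HB.instance Definition _ : EqQuotient _ loc_rel localization :=
  EqQuotient.on localization.
HB.instance Definition _ := Choice.on localization.

Definition loc_frac (a : R) (s : S) : localization := \pi_localization (a, s).

Lemma loc_frac_eq a s b t :
  loc_frac a s = loc_frac b t <->
  exists2 u, (S : set R) u & u * (a * den t) = u * (b * den s).
Proof. by split=> [/eqmodP/asboolP|e]; last apply/eqmodP/asboolP. Qed.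

Lemma loc_fracW (P : localization -> Prop) :
  (forall a s, P (loc_frac a s)) -> forall x, P x.
Proof. by move=> Pf; elim/quotW=> -[a s]; exact: Pf. Qed.

Lemma loc_frac_repr (x : localization) :
  loc_frac (repr x).1 (repr x).2 = x.
Proof. by rewrite /loc_frac -surjective_pairing reprK. Qed.

Definition loc_add (x y : localization) : localization :=
  let: (a, s) := repr x in let: (b, t) := repr y in
  loc_frac (a * den t + b * den s) (den_mul s t).

Definition loc_mul (x y : localization) : localization :=
  let: (a, s) := repr x in let: (b, t) := repr y in
  loc_frac (a * b) (den_mul s t).

Definition loc_opp (x : localization) : localization :=
  let: (a, s) := repr x in loc_frac (- a) s.

Definition loc_zero : localization := loc_frac 0 den_witness.

Definition loc_one : localization := loc_frac (den den_witness) den_witness.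

Lemma loc_addE a s b t : loc_add (loc_frac a s) (loc_frac b t) =
  loc_frac (a * den t + b * den s) (den_mul s t).
Proof.
rewrite /loc_add; have := loc_frac_repr (loc_frac a s).
have := loc_frac_repr (loc_frac b t).
case: (repr _) => b' t' /=; case: (repr _) => a' s' /=.
move=> /loc_frac_eq[v Sv ev] /loc_frac_eq[u Su eu].
apply/loc_frac_eq; exists (u * v); first exact: multset_mul.
rewrite !den_mulE; transitivity (v * den t * den t' * (u * (a' * den s)) +
  u * den s * den s' * (v * (b' * den t))); first by ring.
by rewrite eu ev; ring.
Qed.

Lemma loc_mulE a s b t : loc_mul (loc_frac a s) (loc_frac b t) =
  loc_frac (a * b) (den_mul s t).
Proof.
rewrite /loc_mul; have := loc_frac_repr (loc_frac a s).
have := loc_frac_repr (loc_frac b t).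
case: (repr _) => b' t' /=; case: (repr _) => a' s' /=.
move=> /loc_frac_eq[v Sv ev] /loc_frac_eq[u Su eu].
apply/loc_frac_eq; exists (u * v); first exact: multset_mul.
rewrite !den_mulE; transitivity ((u * (a' * den s)) * (v * (b' * den t)));
  first by ring.
by rewrite eu ev; ring.
Qed.

Lemma loc_oppE a s : loc_opp (loc_frac a s) = loc_frac (- a) s.
Proof.
rewrite /loc_opp; have := loc_frac_repr (loc_frac a s).
case: (repr _) => a' s' /= /loc_frac_eq[u Su eu].
by apply/loc_frac_eq; exists u; rewrite // !mulNr !mulrN eu.
Qed.

Lemma loc_addA : associative loc_add.
Proof.
elim/loc_fracW=> a s; elim/loc_fracW=> b t; elim/loc_fracW=> c u.
rewrite !loc_addE; apply/loc_frac_eq; exists (den s); first exact: denP.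
by rewrite !den_mulE; ring.
Qed.

Lemma loc_addC : commutative loc_add.
Proof.
elim/loc_fracW=> a s; elim/loc_fracW=> b t.
rewrite !loc_addE; apply/loc_frac_eq; exists (den s); first exact: denP.
by rewrite !den_mulE; ring.
Qed.

Lemma loc_add0 : left_id loc_zero loc_add.
Proof.
elim/loc_fracW=> a s.
rewrite loc_addE; apply/loc_frac_eq; exists (den s); first exact: denP.
by rewrite !den_mulE; ring.
Qed.

Lemma loc_addN : left_inverse loc_zero loc_opp loc_add.
Proof.
elim/loc_fracW=> a s.
rewrite loc_oppE loc_addE; apply/loc_frac_eq.
by exists (den s); [exact: denP | rewrite !den_mulE; ring].
Qed.

HB.instance Definition _ :=
  GRing.isZmodule.Build localization loc_addA loc_addC loc_add0 loc_addN.

Lemma loc_mulA : associative loc_mul.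
Proof.
elim/loc_fracW=> a s; elim/loc_fracW=> b t; elim/loc_fracW=> c u.
rewrite !loc_mulE; apply/loc_frac_eq; exists (den s); first exact: denP.
by rewrite !den_mulE; ring.
Qed.

Lemma loc_mulC : commutative loc_mul.
Proof.
elim/loc_fracW=> a s; elim/loc_fracW=> b t.
rewrite !loc_mulE; apply/loc_frac_eq; exists (den s); first exact: denP.
by rewrite !den_mulE; ring.
Qed.

Lemma loc_mul1 : left_id loc_one loc_mul.
Proof.
elim/loc_fracW=> a s.
rewrite loc_mulE; apply/loc_frac_eq; exists (den s); first exact: denP.
by rewrite !den_mulE; ring.
Qed.

Lemma loc_mulDl : left_distributive loc_mul +%R.
Proof.
elim/loc_fracW=> a s; elim/loc_fracW=> b t; elim/loc_fracW=> c u.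
rewrite /GRing.add /= !(loc_addE, loc_mulE); apply/loc_frac_eq.
by exists (den s); [exact: denP | rewrite !den_mulE; ring].
Qed.

HB.instance Definition _ := GRing.Zmodule_isComPzRing.Build localization
  loc_mulA loc_mulC loc_mul1 loc_mulDl.

Lemma loc_fracD a s b t : loc_frac a s + loc_frac b t =
  loc_frac (a * den t + b * den s) (den_mul s t).
Proof. exact: loc_addE. Qed.

Lemma loc_fracN a s : - loc_frac a s = loc_frac (- a) s.
Proof. exact: loc_oppE. Qed.

Lemma loc_fracM a s b t :
  loc_frac a s * loc_frac b t = loc_frac (a * b) (den_mul s t).
Proof. exact: loc_mulE. Qed.

Definition loc_map (r : R) : localization :=
  loc_frac (r * den den_witness) den_witness.

Lemma loc_mapE r s : loc_map r = loc_frac (r * den s) s.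
Proof.
apply/loc_frac_eq; exists (den s); first exact: denP.
by ring.
Qed.

Lemma loc_map_is_zmod_morphism : zmod_morphism loc_map.
Proof.
move=> a b; rewrite /loc_map loc_fracN loc_fracD.
apply/loc_frac_eq; exists (den den_witness); first exact: denP.
by rewrite !den_mulE; ring.
Qed.

Lemma loc_map_is_monoid_morphism : monoid_morphism loc_map.
Proof.
split=> [|a b]; first by rewrite /loc_map mul1r.
rewrite /loc_map loc_fracM.
apply/loc_frac_eq; exists (den den_witness); first exact: denP.
by rewrite !den_mulE; ring.
Qed.

HB.instance Definition _ :=
  GRing.isZmodMorphism.Build R localization loc_map loc_map_is_zmod_morphism.
HB.instance Definition _ :=
  GRing.isMonoidMorphism.Build R localization loc_map
    loc_map_is_monoid_morphism.

End Localization.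

Section Ideals.
Variable R : comPzRingType.
Implicit Types (S : multset R) (I J Q : set R).

(* MathComp's idealr predicates are boolean and always proper; here ideals
   are arbitrary and may be the whole ring. *)
Definition is_ideal I : Prop :=
  [/\ I 0, forall a b, I a -> I b -> I (a + b) & forall r a, I a -> I (r * a)].

Definition ideal_gen (A : set R) : set R :=
  [set x | forall J, is_ideal J -> A `<=` J -> J x].

Definition radical I : set R := [set x | exists2 k, (0 < k)%N & I (x ^+ k)].

Definition colon I (s : R) : set R := [set r | I (s * r)].

Definition n_absorbing (n : nat) I : Prop :=
  is_ideal I /\
  forall r : 'I_n.+1 -> R, I (\prod_i r i) ->
    exists j, I (\prod_(i | i != j) r i).

Definition S_n_absorbing S (n : nat) I : Prop :=
  [/\ is_ideal I, I `&` S = set0 &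
    exists2 s, (S : set R) s & forall r : 'I_n.+1 -> R, I (\prod_i r i) ->
      exists j, I (s * \prod_(i | i != j) r i)].

Definition S_primary S Q : Prop :=
  [/\ is_ideal Q, Q `&` S = set0 &
    exists2 s, (S : set R) s & forall a b, Q (a * b) -> Q (s * a) \/ radical Q (s * b)].

(* The case m = 0, where the intersection is the whole ring, cannot occur:
   s is not in I, so 1 is not in colon I s. *)
Definition S_Laskerian S : Prop :=
  forall I, is_ideal I -> I <> setT -> I `&` S = set0 ->
    exists2 s, (S : set R) s & exists (m : nat) (Q : 'I_m -> set R),
      (forall i, S_primary S (Q i)) /\ colon I s = \bigcap_i Q i.

End Ideals.

Definition loc_extension (R : comPzRingType) (S : multset R) (I : set R) :
    set (localization S) :=
  ideal_gen (@loc_map R S @` I).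
Arguments loc_extension {R} S I _.

(* Main.v *)
Require Import Defs.
From mathcomp Require Import all_boot all_algebra ring.
From mathcomp Require Import boolp classical_sets.

(* Let J be the preimage of I R_S in R, that is, the set of r with u r in I for
   some u in S. Whatever the ring, I R_S is n-absorbing as soon as I is
   S-n-absorbing, and the converse holds once a single t in S satisfies t J <= I.
   The S-Laskerian hypothesis provides such a t: write I : s as a finite
   intersection of S-primary ideals Q_i. If u r lies in Q_i with u in S, then no
   power of s_i u lies in Q_i, so s_i r does; hence t = s * prod_i s_i works. *)

Import GRing.Theory.
Local Open Scope ring_scope.
Local Open Scope classical_set_scope.

(** The leading factor [s] covers the empty product, as [1] may lie outside [S]. *)
Lemma multset_mul_prod (R : comPzRingType) (S : multset R) (J : finType)
    (P : pred J) (s : R) (f : J -> R) :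
  (S : set R) s -> (forall j, (S : set R) (f j)) ->
  (S : set R) (s * \prod_(j | P j) f j).
Proof.
move=> Ss Sf.
(* The induction runs on the property that multiplication by [x] maps [S] into itself, which holds
   for [1] as well. *)
apply: (big_ind (fun x => forall s, (S : set R) s -> (S : set R) (s * x))) => //.
- by move=> x; rewrite mulr1.
- by move=> x y Sx Sy z Sz; rewrite mulrA; apply/Sy/Sx.
- by move=> j _ z Sz; exact: multset_mul.
Qed.

Lemma multset_exp (R : comPzRingType) (S : multset R) (s : R) (k : nat) :
  (S : set R) s -> (0 < k)%N -> (S : set R) (s ^+ k).
Proof.
case: k => // k Ss _; elim: k => [|k IHk]; first by rewrite expr1.
by rewrite exprS; exact: multset_mul.
Qed.

Lemma loc_extension_frac (R : comPzRingType) (S : multset R) (I : set R)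
    (a : R) (s : S) : is_ideal I ->
  loc_extension S I (loc_frac a s) <-> exists2 u, (S : set R) u & I (u * a).
Proof.
move=> [I0 ID IM]; split=> [ext|[u Su Iua] J [_ _ JM] IJ]; last first.
  pose v : S := exist _ u (mem_set Su); have vE : den v = u by [].
  (* The first factor on the right is [1 / (u * s)]. *)
  have -> : loc_frac a s =
      loc_frac (den s) (den_mul (den_mul v s) s) * loc_map S (u * a).
    rewrite (loc_mapE _ s) loc_fracM; apply/loc_frac_eq.
    exists (den s); first exact: denP.
    by rewrite !den_mulE vE; ring.
  by apply/JM/IJ; exists (u * a).
(* The fractions with numerator in [I] form an ideal containing the image of [I], so the generated
   ideal is no larger. *)
have [] := ext [set x | exists b (t : S), I b /\ x = loc_frac b t].
- split.
  + exists 0, s; split=> //.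
    by have := loc_mapE (S := S) 0 s; rewrite rmorph0 mul0r.
  + move=> _ _ [b [t [Ib ->]]] [c [v [Ic ->]]].
    exists (b * den v + c * den t), (den_mul t v); split; last exact: loc_fracD.
    by apply: ID; rewrite mulrC; exact: IM.
  + elim/loc_fracW=> c v _ [b [t [Ib ->]]].
    exists (c * b), (den_mul v t); split; last exact: loc_fracM.
    exact: IM.
- move=> _ [b Ib <-]; exists (b * den s), s; split; last exact: loc_mapE.
  by rewrite mulrC; exact: IM.
move=> b [t [Ib /loc_frac_eq[u Su eu]]].
exists (u * den t); first exact: multset_mul (denP _).
have -> : u * den t * a = u * (a * den t) by ring.
by rewrite eu [b * _]mulrC; do 2 apply: (IM).
Qed.

Lemma loc_extension_map (R : comPzRingType) (S : multset R) (I : set R) (a : R) :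
  is_ideal I ->
  loc_extension S I (loc_map S a) <-> exists2 u, (S : set R) u & I (u * a).
Proof.
move=> idI; have [_ _ IM] := idI.
apply: (iff_trans (loc_extension_frac _ _ _ _ _ idI)); split=> -[u Su Iu].
  exists (u * den (den_witness S)); first exact: multset_mul (denP _).
  by rewrite -mulrA [_ * a]mulrC.
by exists u; rewrite // mulrA mulrC; exact: IM.
Qed.

(* The factor den_witness accounts for the empty product, since 1 may lie
   outside S. *)
Lemma loc_frac_prod (R : comPzRingType) (S : multset R) (J : finType)
    (P : pred J) (a : J -> R) (t : J -> S) :
  exists T : S, \prod_(j | P j) loc_frac (a j) (t j) =
    loc_frac (den (den_witness S) * \prod_(j | P j) a j) T.
Proof.
apply: (big_rec2 (fun (x : localization S) y =>
  exists T, x = loc_frac (den (den_witness S) * y) T)).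
  by exists (den_witness S); rewrite mulr1.
move=> j y x _ [T ->]; exists (den_mul (t j) T).
by rewrite loc_fracM mulrCA.
Qed.

Lemma loc_extension_prod (R : comPzRingType) (S : multset R) (I : set R)
    (J : finType) (P : pred J) (a : J -> R) (t : J -> S) : is_ideal I ->
  loc_extension S I (\prod_(j | P j) loc_frac (a j) (t j)) <->
  exists2 u, (S : set R) u & I (u * \prod_(j | P j) a j).
Proof.
move=> idI; have [_ _ IM] := idI; have [T ->] := loc_frac_prod _ S _ P a t.
apply: (iff_trans (loc_extension_frac _ _ _ _ _ idI)); split=> -[u Su Iu].
  exists (u * den (den_witness S)); first exact: multset_mul (denP _).
  by rewrite -mulrA.
by exists u => //; rewrite mulrCA; exact: IM.
Qed.

Lemma is_ideal_loc_extension (R : comPzRingType) (S : multset R) (I : set R) :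
  is_ideal (loc_extension S I).
Proof.
split=> [J [J0 _ _] //|x y Ex Ey J idJ IJ|z x Ex J idJ IJ];
  have [_ JD JM] := idJ.
  by apply: JD; [exact: Ex | exact: Ey].
by apply: JM; exact: Ex.
Qed.

Lemma S_primary_colon (R : comPzRingType) (S : multset R) (Q : set R) :
  S_primary S Q ->
  exists2 s, (S : set R) s & forall u r, (S : set R) u -> Q (u * r) -> Q (s * r).
Proof.
move=> [_ QS0 [s Ss primQ]]; exists s => // u r Su; rewrite mulrC.
case/primQ=> // -[k k_gt0 Qk].
(* The exponent is positive, so the power stays in [S] even when [1] does not belong to it. *)
suff : (Q `&` S) ((s * u) ^+ k) by rewrite QS0.
by split=> //; apply: multset_exp k_gt0; exact: multset_mul.
Qed.

Lemma S_Laskerian_colon (R : comPzRingType) (S : multset R) (I : set R) :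
  is_ideal I -> I `&` S = set0 -> S_Laskerian S ->
  exists2 t, (S : set R) t & forall u r, (S : set R) u -> I (u * r) -> I (t * r).
Proof.
move=> idI IS0 lask; have [_ _ IM] := idI.
have IneT : I <> setT.
  move=> IT; have [s Ss] := multset_nonempty S.
  have IS : (I `&` S) s by rewrite IT.
  by move: IS; rewrite IS0.
have [s Ss [m [Q [primQ colonE]]]] := lask I idI IneT IS0.
have /choice[f fP] : forall i, exists x, (S : set R) x /\
    forall u r, (S : set R) u -> Q i (u * r) -> Q i (x * r).
  by move=> i; have [x Sx Qx] := S_primary_colon _ _ _ (primQ i); exists x.
exists (s * \prod_i f i).
  by apply: multset_mul_prod => // i; case: (fP i).
move=> u r Su Iur; rewrite -mulrA.
suff : colon I s (\prod_i f i * r) by [].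
rewrite colonE => i _.
(* [I] is contained in [colon I s], so [u * r] lies in every [Q i]. *)
have : colon I s (u * r) by exact: IM.
rewrite colonE => /(_ i Logic.I) Qur.
have [[_ _ QM] _ _] := primQ i.
rewrite (bigD1 i) //= [f i * _]mulrC -mulrA; apply: QM.
by case: (fP i) => _; apply; [exact: Su|].
Qed.

Theorem theorem3p4 (R : comPzRingType) (S : multset R) (I : set R) (n : nat)
    (n_gt0 : (0 < n)%N) (idealI : is_ideal I) (disjIS : I `&` S = set0)
    (laskR : S_Laskerian S) :
  n_absorbing n (loc_extension S I) <-> S_n_absorbing S n I.
Proof.
have [_ _ IM] := idealI.
split=> [[_ absE]|[_ _ [s Ss absI]]].
  split=> //; have [t St colonI] := S_Laskerian_colon _ _ _ idealI disjIS laskR.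
  exists t => // r Ir.
  (* The denominator [u] obtained below depends on [r]; [colonI] trades it for the uniform [t]. *)
  have [|j] := absE (fun i => loc_map S (r i)).
    rewrite -rmorph_prod => J _; apply.
    by exists (\prod_i r i).
  rewrite -rmorph_prod => /(loc_extension_map _ _ _ _ idealI)[u Su Iu].
  by exists j; exact: colonI Su Iu.
split; first exact: is_ideal_loc_extension.
move=> x; pose a i := (repr (x i)).1; pose t i := (repr (x i)).2.
have -> : x = fun i => loc_frac (a i) (t i).
  by apply: funext => i; rewrite loc_frac_repr.
case/(loc_extension_prod _ _ _ _ _ _ _ idealI) => c Sc Ica.
(* Scaling every factor by [c] gives a product [c ^+ n.+1 * \prod_i a i], a multiple of the element
   [c * \prod_i a i] of [I]. *)
have [|j Ij] := absI (fun i => c * a i).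
  rewrite big_split /= big_ord_recl -mulrA mulrCA.
  exact: IM.
exists j; apply/(loc_extension_prod _ _ _ _ _ _ _ idealI).
(* This collects [s] and the copies of [c] left once the factor [j] is dropped. *)
exists (s * \prod_(i | i != j) c); first exact: multset_mul_prod.
by rewrite -mulrA -big_split.
Qed.
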